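(* Let $G=(\mathcal{S},\mathcal{W})$ be a Hamiltonian vertex-transitive simple graph on $N$ vertices. Then its PIR capacity satisfies \[ \mathscr{C}(G)\le \frac{2}{N+1}. \]
   Context: A graph is Hamiltonian if it has a cycle through all vertices, and vertex-transitive if its automorphism group acts transitively on its vertices. Graph-based PIR model (non-colluding servers, 2-replication): vertices are servers, edges are files, each file stored on the two endpoints of its edge; files are independent, each uniform on $\mathbb{F}_2^L$. A user wants $W_\theta$, $\theta$ uniform on the file indices and independent of the files; it sends queries $Q_1,\dots,Q_N$ (independent of the files) to the servers; server $i$ answers $A_i$, a deterministic function of $Q_i$ and the files stored on it. Reliability: $W_\theta$ is determined by all answers and queries. Privacy: $H(\theta\mid Q_i,W_{S_i})=H(\theta)$ for every server $i$, where $W_{S_i}$ is the set of files on server $i$. The rate is $L/\sum_i H(A_i)$; the PIR capacity $\mathscr{C}(G)$ is the supremum of rates over all schemes and file lengths $L$. *)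

(* Defs.v *)
From HB Require Import structures.
From mathcomp Require Import all_boot all_order all_algebra all_fingroup.
From mathcomp Require Import all_classical all_reals all_analysis.
Set Implicit Arguments. Unset Strict Implicit. Unset Printing Implicit Defensive.
Import Order.TTheory GRing.Theory Num.Theory.
Local Open Scope ring_scope.

Section Graph.
Variable V : finType.

Definition simple_graph (e : rel V) : Prop := irreflexive e /\ symmetric e.

Definition hamiltonian (e : rel V) : Prop :=
  (3 <= #|V|)%N /\
  exists s : seq V, [/\ uniq s, size s = #|V| & path.cycle e s].

Definition vertex_transitive (e : rel V) : Prop :=
  forall x y : V, exists s : {perm V},
    s x = y /\ forall a b : V, e (s a) (s b) = e a b.

Definition is_edge (e : rel V) (S : {set V}) : bool :=
  [exists x, exists y, e x y && (S == [set x; y])].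

Definition edge_t (e : rel V) : finType := {S : {set V} | is_edge e S}.
End Graph.

Section Entropy.
Variables (R : realType) (Omega : finType) (P : Omega -> R).

Definition log2 (x : R) : R := ln x / ln 2.

Definition prob_of (T : finType) (X : Omega -> T) (t : T) : R :=
  \sum_(w | X w == t) P w.

Definition entropy (T : finType) (X : Omega -> T) : R :=
  - \sum_(t : T) (if prob_of X t == 0 then 0
                  else prob_of X t * log2 (prob_of X t)).

Definition cond_entropy (T U : finType) (X : Omega -> T) (Y : Omega -> U) : R :=
  entropy (fun w => (X w, Y w)) - entropy Y.
End Entropy.

(* Graph-based PIR model.                                             *)
(* Files: W : {ffun edge_t e -> 'rV['F_2]_L}, i.i.d. uniform.         *)
(* theta uniform on edges, independent of W.                          *)
(* Queries: the query tuple (Q_v)_v has conditional law kappa theta,  *)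
(*   hence is independent of the files.                               *)
(* Answers: A_v = ans v (Q_v) W, depending only on files stored at v. *)
Section PIR.
Variables (R : realType) (V : finType) (e : rel V) (L : nat) (Qt At : finType).

Definition files_t := {ffun edge_t e -> 'rV['F_2]_L}.
Definition queries_t := {ffun V -> Qt}.
Definition answers_t := {ffun V -> At}.
Definition outcome := (edge_t e * queries_t * files_t)%type.

Definition pir_prob (kappa : edge_t e -> queries_t -> R) (o : outcome) : R :=
  (#|edge_t e|%:R)^-1 * kappa o.1.1 o.1.2 * (#|files_t|%:R)^-1.

Definition rv_theta (o : outcome) : edge_t e := o.1.1.
Definition rv_Q (v : V) (o : outcome) : Qt := o.1.2 v.
(* W_{S_v}: the files stored at server v (others masked) *)
Definition rv_WS (v : V) (o : outcome) : {ffun edge_t e -> option 'rV['F_2]_L} :=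
  [ffun S : edge_t e => if v \in val S then Some (o.2 S) else None].
Definition rv_A (ans : V -> Qt -> files_t -> At) (v : V) (o : outcome) : At :=
  ans v (o.1.2 v) o.2.

Definition is_pir_scheme (kappa : edge_t e -> queries_t -> R)
    (ans : V -> Qt -> files_t -> At) : Prop :=
  [/\ (forall k q, 0 <= kappa k q),
      (forall k, \sum_(q : queries_t) kappa k q = 1),
      (forall v q (w w' : files_t),
          (forall S : edge_t e, v \in val S -> w S = w' S) ->
          ans v q w = ans v q w'),
      (exists dec : queries_t -> answers_t -> 'rV['F_2]_L,
          forall o : outcome, 0 < pir_prob kappa o ->
            dec o.1.2 [ffun v => rv_A ans v o] = o.2 o.1.1) &
      (forall v : V,
          cond_entropy (pir_prob kappa) rv_theta
                       (fun o => (rv_Q v o, rv_WS v o))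
          = entropy (pir_prob kappa) rv_theta)].

Definition pir_rate (kappa : edge_t e -> queries_t -> R)
    (ans : V -> Qt -> files_t -> At) : R :=
  L%:R / \sum_(v : V) entropy (pir_prob kappa) (rv_A ans v).
End PIR.

Definition pir_capacity (R : realType) (V : finType) (e : rel V) : \bar R :=
  ereal_sup [set x : \bar R | exists (L : nat) (Qt At : finType)
      (kappa : edge_t e -> queries_t V Qt -> R)
      (ans : V -> Qt -> files_t e L -> At),
      [/\ (0 < L)%N, is_pir_scheme kappa ans & x = (pir_rate kappa ans)%:E]].

(* Main.v *)
(** Fix the queries and write [h(v, j)] for the entropy of the answer of [v]
    given all files except [j]. If the requested file [k] is an edge of the
    Hamiltonian cycle, deleting [k] leaves a path [v_0, ..., v_n] with
    [n = N - 1]. The answers have joint entropy at least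
    [L + H(A | W_k, files off the path)], and revealing the path files one after
    another from either end bounds the last term below by
    [sum_i h(v_i, j_i)] and by [sum_i h(v_{i+1}, j_i)], where
    [j_i = {v_i, v_{i+1}}]. By privacy, the mean of [h(v, j)] over the queries
    does not depend on the requested file; when that file is [j_i], its two
    endpoints must supply all of it, so
    [h(v_i, j_i) + h(v_{i+1}, j_i) >= L] on average. Averaging both directions,
    the answers have total entropy at least [L + n L / 2 = L (N + 1) / 2]. *)
Require Import Defs.
From HB Require Import structures.
From mathcomp Require Import all_boot all_order all_algebra all_fingroup.
From mathcomp Require Import all_classical all_reals all_analysis.
From mathcomp Require Import zify ring lra.
Import Order.TTheory GRing.Theory Num.Theory.
Local Open Scope ring_scope.
Set Implicit Arguments. Unset Strict Implicit. Unset Printing Implicit Defensive.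

(** * Gibbs' inequality and its equality case *)

Section Gibbs.
Variable R : realType.
Implicit Types p q : R.

Lemma ln2_gt0 : 0 < ln (2 : R).
Proof. by rewrite ln_gt0 // ltr1n. Qed.

Lemma log2M p q : 0 < p -> 0 < q -> log2 (p * q) = log2 p + log2 q.
Proof. by move=> p0 q0; rewrite /log2 lnM ?posrE // mulrDl. Qed.

Lemma log2V p : 0 < p -> log2 p^-1 = - log2 p.
Proof. by move=> p0; rewrite /log2 lnV ?posrE // mulNr. Qed.

Lemma log2X p n : 0 < p -> log2 (p ^+ n) = n%:R * log2 p.
Proof. by move=> p0; rewrite /log2 lnXn // mulrA mulr_natl. Qed.

Lemma log2_2 : log2 (2 : R) = 1.
Proof. by rewrite /log2 divff // gt_eqF // ln2_gt0. Qed.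

Lemma ler_log2 p q : 0 < p -> p <= q -> log2 p <= log2 q.
Proof.
move=> p0 pq; rewrite /log2 ler_pM2r ?invr_gt0 ?ln2_gt0 //.
by rewrite ler_ln ?posrE // (lt_le_trans p0).
Qed.

Lemma ln_leif p : 0 < p -> ln p <= p - 1 ?= iff (p == 1).
Proof.
move=> p0; have [->|p1] := eqVneq p 1; first by rewrite ln1 subrr; apply/leif_refl.
have lnp0 : ln p != 0 by rewrite ln_eq0.
have := expR_gt1Dx lnp0; rewrite lnK ?posrE // => lt; split.
  by rewrite lerBrDl ltW.
by apply/negbTE; rewrite lt_eqF // ltrBrDl.
Qed.

(** This is [ln x <= x - 1] at [x = q / p], scaled by [p / ln 2]. The [leif] form carries the
    equality case through summation. *)
Lemma gibbs_term p q : 0 <= p -> 0 <= q -> (0 < p -> 0 < q) ->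
  p * log2 q <= p * log2 p + (q - p) / ln 2 ?= iff (p == q).
Proof.
move=> p0 q0 pq; have l2 := ln2_gt0.
have [p00|p_gt0] := eqVneq p 0.
  rewrite p00 !mul0r add0r subr0; split.
    by rewrite divr_ge0 // ltW.
  by rewrite eq_sym [in RHS]eq_sym mulf_eq0 invr_eq0 (gt_eqF l2) orbF.
have {}p_gt0 : 0 < p by rewrite lt_def p_gt0.
have {}q_gt0 := pq p_gt0.
have [lelog eqlog] := ln_leif (divr_gt0 q_gt0 p_gt0).
have E : p * log2 p + (q - p) / ln 2 - p * log2 q
       = p / ln 2 * ((q / p - 1) - ln (q / p)).
  rewrite ln_div ?posrE // /log2; field.
  by rewrite !gt_eqF.
have c0 : 0 < p / ln 2 by rewrite divr_gt0.
split; first by rewrite -subr_ge0 E pmulr_rge0 // subr_ge0.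
rewrite -subr_eq0 -oppr_eq0 opprB E mulf_eq0 (gt_eqF c0) /= subr_eq0 eq_sym eqlog.
by rewrite -[1](divff (lt0r_neq0 p_gt0)) (inj_eq (divIf (lt0r_neq0 p_gt0))) eq_sym.
Qed.

Lemma gibbs (T : finType) (p q : T -> R) :
    (forall t, 0 <= p t) -> (forall t, 0 <= q t) ->
    (forall t, 0 < p t -> 0 < q t) -> \sum_t q t <= \sum_t p t ->
  \sum_t p t * log2 (q t) <= \sum_t p t * log2 (p t).
Proof.
move=> p0 q0 pq spq.
have := leif_sum (fun t (_ : xpredT t) => gibbs_term (p0 t) (q0 t) (pq t)).
move=> [le _]; apply: (le_trans le); rewrite big_split /= -mulr_suml sumrB.
by rewrite gerDl pmulr_lle0 ?subr_le0 // invr_gt0 ln2_gt0.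
Qed.

(** With equal masses the linear corrections cancel, so equality of the sums forces equality in
    every term. *)
Lemma gibbs_eq (T : finType) (p q : T -> R) :
    (forall t, 0 <= p t) -> (forall t, 0 <= q t) ->
    (forall t, 0 < p t -> 0 < q t) -> \sum_t q t = \sum_t p t ->
    \sum_t p t * log2 (q t) = \sum_t p t * log2 (p t) ->
  p =1 q.
Proof.
move=> p0 q0 pq spq eqpq t.
have := leif_sum (fun t (_ : xpredT t) => gibbs_term (p0 t) (q0 t) (pq t)).
move=> [_ ]; rewrite big_split /= -mulr_suml sumrB spq subrr mul0r addr0 eqpq eqxx.
by move/esym/forallP/(_ t)/eqP.
Qed.

Lemma sum_pair (A B : finType) (G : A * B -> R) :
  \sum_p G p = \sum_a \sum_b G (a, b).
Proof. by rewrite pair_bigA; apply: eq_bigr => -[]. Qed.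

End Gibbs.

(** Required at every outcome, not just almost surely, so no probability has to be mentioned. *)
Definition determines (Omega T U : Type) (X : Omega -> T) (Y : Omega -> U) :=
  forall w w', X w = X w' -> Y w = Y w'.

(** * Shannon inequalities on a finite space *)

Section Shannon.
Variables (R : realType) (Omega : finType) (P : Omega -> R).
Hypothesis P_ge0 : forall w, 0 <= P w.

Local Notation pr := (prob_of P).
Local Notation H := (entropy P).

Lemma prob_of_ge0 (T : finType) (X : Omega -> T) t : 0 <= pr X t.
Proof. exact: sumr_ge0. Qed.

Lemma prob_of_sumM (T : finType) (X : Omega -> T) (g : T -> R) :
  \sum_t pr X t * g t = \sum_w P w * g (X w).
Proof.
rewrite [RHS](partition_big X xpredT) //=; apply: eq_bigr => t _.
by rewrite mulr_suml; apply: eq_bigr => w /eqP ->.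
Qed.

Lemma sum_prob_of (T : finType) (X : Omega -> T) : \sum_t pr X t = \sum_w P w.
Proof.
have := prob_of_sumM X (fun=> 1).
by under eq_bigr do rewrite mulr1; under [RHS]eq_bigr do rewrite mulr1.
Qed.

Lemma prob_of_comp (T U : finType) (X : Omega -> T) (f : T -> U) u :
  pr (fun w => f (X w)) u = \sum_(t | f t == u) pr X t.
Proof.
rewrite /prob_of (partition_big X (fun t => f t == u)) //=.
apply: eq_bigr => t /eqP fu; apply: eq_bigl => w.
by case: (X w =P t) => [->|]; rewrite ?fu ?eqxx ?andbF.
Qed.

Lemma prob_of_marginal (T U : finType) (X : Omega -> T) (Y : Omega -> U) u :
  \sum_t pr (fun w => (X w, Y w)) (t, u) = pr Y u.
Proof.
rewrite (prob_of_comp (fun w => (X w, Y w)) snd).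
rewrite [RHS](reindex (fun t => (t, u))) /=; last first.
  by exists fst => [//|[t u']]; rewrite inE => /eqP/= ->.
by apply: eq_bigl => t; rewrite eqxx.
Qed.

Lemma prob_of_gt0 (T : finType) (X : Omega -> T) w : 0 < P w -> 0 < pr X (X w).
Proof.
move=> Pw; rewrite /prob_of (bigD1 w) //=.
by rewrite ltr_pwDl // sumr_ge0.
Qed.

Lemma prob_of_le (T U : finType) (X : Omega -> T) (Y : Omega -> U) w :
  determines X Y -> pr X (X w) <= pr Y (Y w).
Proof.
move=> XY; rewrite /prob_of [leRHS](bigID (fun w' => X w' == X w)) /=.
rewrite [X in _ <= X + _](eq_bigl (fun w' => X w' == X w)) => [|w'].
  by rewrite lerDl sumr_ge0.
by case: (X w' =P X w) => [/XY ->|_]; rewrite ?eqxx ?andbF.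
Qed.

Lemma entropyE (T : finType) (X : Omega -> T) :
  H X = - \sum_t pr X t * log2 (pr X t).
Proof.
congr (- _); apply: eq_bigr => t _.
by case: eqP => // ->; rewrite mul0r.
Qed.

(** Written as an expectation over outcomes, entropies of variables with different ranges can be
    compared outcome by outcome. *)
Lemma entropy_sum (T : finType) (X : Omega -> T) :
  H X = - \sum_w P w * log2 (pr X (X w)).
Proof. by rewrite entropyE (prob_of_sumM X (fun t => log2 (pr X t))). Qed.

Lemma entropy_determines (T U : finType) (X : Omega -> T) (Y : Omega -> U) :
  determines X Y -> H Y <= H X.
Proof.
move=> XY; rewrite !entropy_sum lerN2; apply: ler_sum => w _.
have [->|Pw] := eqVneq (P w) 0; first by rewrite !mul0r.
have {}Pw : 0 < P w by rewrite lt_def Pw P_ge0.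
by rewrite ler_pM2l // ler_log2 ?prob_of_gt0 ?prob_of_le.
Qed.

(** The bound is a cross-entropy. It is applied with [q] the uniform law, a conditionally
    independent law, and the averaged law of an answer. *)
Lemma entropy_gibbs (T : finType) (X : Omega -> T) (q : T -> R) :
    (forall t, 0 <= q t) -> (forall t, 0 < pr X t -> 0 < q t) ->
    \sum_t q t <= \sum_w P w ->
  H X <= - \sum_w P w * log2 (q (X w)).
Proof.
move=> q0 pq sq; rewrite entropyE -(prob_of_sumM X (fun t => log2 (q t))) lerN2.
by apply: gibbs => //; [move=> t; exact: prob_of_ge0|rewrite sum_prob_of].
Qed.

Lemma entropy_le_log_card (T : finType) (X : Omega -> T) :
  \sum_w P w = 1 -> H X <= log2 (#|T|%:R).
Proof.
move=> P1; have [T0|T_gt0] := posnP #|T|.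
  rewrite entropyE big1 => [|t]; last by move: (card0_eq T0 t); rewrite inE.
  by rewrite oppr0 T0 /log2 ln0 // mul0r.
have T0 : 0 < #|T|%:R :> R by rewrite ltr0n.
have -> : log2 #|T|%:R = - \sum_w P w * log2 (#|T|%:R^-1 : R).
  by rewrite -mulr_suml P1 mul1r log2V // opprK.
apply: (entropy_gibbs (q := fun=> #|T|%:R^-1)) => [t|t _|].
- by rewrite invr_ge0 ltW.
- by rewrite invr_gt0.
- by rewrite P1 sumr_const -[_ *+ _]mulr_natl mulfV // gt_eqF.
Qed.

(** Gibbs' inequality against the law that keeps the marginals of [(X, Z)] and [(Y, Z)] but makes
    [X] and [Y] independent given [Z]. The rules for conditional entropy below follow from it. *)
Lemma entropy_submodular (A B C : finType)
    (X : Omega -> A) (Y : Omega -> B) (Z : Omega -> C) :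
  H (fun w => (X w, Y w, Z w)) + H Z
    <= H (fun w => (X w, Z w)) + H (fun w => (Y w, Z w)).
Proof.
pose XZ w := (X w, Z w); pose YZ w := (Y w, Z w); pose XYZ w := (X w, Y w, Z w).
pose q (t : A * B * C) := pr XZ (t.1.1, t.2) * pr YZ (t.1.2, t.2) / pr Z t.2.
have margX z : \sum_x pr XZ (x, z) = pr Z z by exact: prob_of_marginal.
have margY z : \sum_y pr YZ (y, z) = pr Z z by exact: prob_of_marginal.
have q0 t : 0 <= q t by rewrite divr_ge0 ?mulr_ge0 ?prob_of_ge0.
have pos w : 0 < P w -> [/\ 0 < pr XZ (XZ w), 0 < pr YZ (YZ w) & 0 < pr Z (Z w)].
  by move=> Pw; rewrite !prob_of_gt0.
have le : H XYZ <= - \sum_w P w * log2 (q (XYZ w)).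
  apply: entropy_gibbs => //.
- move=> t; rewrite /prob_of => t0.
  have [w /andP[/eqP <- Pw]] : exists w, (XYZ w == t) && (0 < P w).
    apply/existsP; apply: contraTT t0; rewrite negb_exists => /forallP no.
    rewrite -leNgt sumr_le0 // => w wt.
    by have := no w; rewrite wt /= -leNgt.
  by have [? ? ?] := pos w Pw; rewrite divr_gt0 ?mulr_gt0.
- rewrite -(sum_prob_of Z) sum_pair.
  rewrite exchange_big /=; apply: ler_sum => z _.
  rewrite sum_pair /q /=.
  under eq_bigr do rewrite -mulr_suml -mulr_sumr margY.
  rewrite -!mulr_suml margX.
  (* The mass of [q] over [z] is [pr Z z * pr Z z / pr Z z]; at a null [z] both sides vanish. *)
  have [->|z0] := eqVneq (pr Z z) 0; first by rewrite !mul0r.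
  by rewrite mulfK.
rewrite -/XZ -/YZ -/XYZ -lerBrDr; apply: (le_trans le).
rewrite !entropy_sum -[- _ - _]opprD -opprB lerN2 opprK addrC -big_split -sumrB /=.
apply: ler_sum => w _.
have [->|Pw] := eqVneq (P w) 0; first by rewrite !mul0r addr0 subr0.
have {}Pw : 0 < P w by rewrite lt_def Pw P_ge0.
have [? ? ?] := pos w Pw.
by rewrite /q /= !log2M ?log2V ?mulr_gt0 ?invr_gt0 // -mulrDr -mulrBr.
Qed.

End Shannon.

(** * Conditional entropy and independence *)

Section ConditionalEntropy.
Variables (R : realType) (Omega : finType) (P : Omega -> R).
Hypothesis P_ge0 : forall w, 0 <= P w.

Local Notation H := (entropy P).

Lemma cond_entropy_pair_le (A B C : finType)
    (X : Omega -> A) (Y : Omega -> B) (Z : Omega -> C) :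
  cond_entropy P (fun w => (X w, Y w)) Z
    <= cond_entropy P X Z + cond_entropy P Y Z.
Proof.
by have := entropy_submodular P_ge0 X Y Z; rewrite /cond_entropy; lra.
Qed.

Lemma cond_entropy_determines (A B C : finType)
    (X : Omega -> A) (Y : Omega -> B) (Z : Omega -> C) :
  determines Z Y -> cond_entropy P X Z <= cond_entropy P X Y.
Proof.
move=> ZY; have := entropy_submodular P_ge0 X Z Y.
have : H (fun w => (X w, Z w)) <= H (fun w => (X w, Z w, Y w)).
  by apply: entropy_determines => // w w' [-> -> _].
have : H (fun w => (Z w, Y w)) <= H Z.
  by apply: entropy_determines => // w w' E; rewrite E (ZY _ _ E).
by rewrite /cond_entropy; lra.
Qed.

(** One step of the revealing argument: the part [X] of [Y] is charged under [Z], and the rest under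
    the richer [Z'], which already yields [X] and [Z]. *)
Lemma cond_entropy_chain (A B C D : finType)
    (X : Omega -> A) (Y : Omega -> B) (Z : Omega -> C) (Z' : Omega -> D) :
    determines Y X -> determines Z' X -> determines Z' Z ->
  cond_entropy P X Z + cond_entropy P Y Z' <= cond_entropy P Y Z.
Proof.
move=> YX Z'X Z'Z; pose XZ w := (X w, Z w).
have := entropy_submodular P_ge0 Y Z' XZ.
have : H (fun w => (Y w, Z' w)) <= H (fun w => (Y w, Z' w, XZ w)).
  by apply: entropy_determines => // w w' [-> -> _].
have : H (fun w => (Y w, XZ w)) <= H (fun w => (Y w, Z w)).
  by apply: entropy_determines => // w w' [E E']; rewrite /XZ E E' (YX _ _ E).
have : H (fun w => (Z' w, XZ w)) <= H Z'.
  apply: entropy_determines => // w w' E.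
  by rewrite /XZ E (Z'X _ _ E) (Z'Z _ _ E).
by rewrite /cond_entropy -/XZ; lra.
Qed.

Lemma cond_entropy_ge0 (A B : finType) (X : Omega -> A) (Y : Omega -> B) :
  0 <= cond_entropy P X Y.
Proof. by rewrite subr_ge0 entropy_determines // => w w' [_ ->]. Qed.

Hypothesis P_sum1 : \sum_w P w = 1.

Lemma entropy_const (A : finType) (X : Omega -> A) :
  (forall w w', X w = X w') -> H X = 0.
Proof.
move=> Xc; rewrite entropy_sum big1 ?oppr0 // => w _.
rewrite /prob_of (eq_bigl xpredT) ?P_sum1 ?/log2 ?ln1 ?mul0r ?mulr0 // => w'.
by rewrite (Xc w' w) eqxx.
Qed.

Lemma entropy_pair_le (A B : finType) (X : Omega -> A) (Y : Omega -> B) :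
  H (fun w => (X w, Y w)) <= H X + H Y.
Proof.
have := entropy_submodular P_ge0 X Y (fun=> tt).
have -> : H (fun=> tt) = 0 by exact: entropy_const.
have : H (fun w => (X w, Y w)) <= H (fun w => (X w, Y w, tt)).
  by apply: entropy_determines => // w w' [-> ->].
have : H (fun w => (X w, tt)) <= H X.
  by apply: entropy_determines => // w w' ->.
have : H (fun w => (Y w, tt)) <= H Y.
  by apply: entropy_determines => // w w' ->.
lra.
Qed.

(** The hypothesis is equality in Gibbs' inequality between the joint law and the product of the
    marginals. *)
Lemma indep_of_cond_entropy (A B : finType) (X : Omega -> A) (Y : Omega -> B) :
    cond_entropy P X Y = H X ->
  forall x y, prob_of P (fun w => (X w, Y w)) (x, y) = prob_of P X x * prob_of P Y y.
Proof.
move=> HXY x y; pose XY w := (X w, Y w).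
pose q (t : A * B) := prob_of P X t.1 * prob_of P Y t.2.
have pos w : 0 < P w -> 0 < prob_of P X (X w) /\ 0 < prob_of P Y (Y w).
  by move=> Pw; split; exact: prob_of_gt0.
apply: (gibbs_eq (p := prob_of P XY) (q := q)) => [t|t|[a b]||].
- exact: prob_of_ge0.
- by rewrite mulr_ge0 ?prob_of_ge0.
- move=> t0; rewrite /q /= mulr_gt0 //; apply: (lt_le_trans t0).
    rewrite -(prob_of_marginal P Y X) (bigD1 b) //= /prob_of.
    rewrite [X in _ <= X + _](eq_bigl (fun w => XY w == (a, b))); last first.
      by move=> w; rewrite -!pair_eqE /= andbC.
    by rewrite lerDl sumr_ge0 // => b' _; apply: prob_of_ge0.
  rewrite -(prob_of_marginal P X Y) (bigD1 a) //= /prob_of.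
  by rewrite lerDl sumr_ge0 // => b' _; apply: prob_of_ge0.
- rewrite !sum_prob_of sum_pair /q /=.
  by under eq_bigr do rewrite -mulr_sumr sum_prob_of P_sum1 mulr1; rewrite sum_prob_of.
rewrite !prob_of_sumM; move: HXY; rewrite /cond_entropy !entropy_sum.
move=> /eqP; rewrite subr_eq -opprD eqr_opp => /eqP; rewrite -/XY => ->.
rewrite -big_split; apply: eq_bigr => w _ /=.
have [->|Pw] := eqVneq (P w) 0; first by rewrite !mul0r addr0.
have {}Pw : 0 < P w by rewrite lt_def Pw P_ge0.
by have [? ?] := pos w Pw; rewrite /q /= log2M // mulrDr.
Qed.

Lemma indep_expectation (A B : finType) (X : Omega -> A) (Y : Omega -> B)
    (f : A -> R) (g : B -> R) :
    cond_entropy P X Y = H X ->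
  \sum_w P w * (f (X w) * g (Y w))
    = (\sum_w P w * f (X w)) * (\sum_w P w * g (Y w)).
Proof.
move=> HXY; pose XY w := (X w, Y w).
rewrite -(prob_of_sumM P XY (fun t => f t.1 * g t.2)).
rewrite -(prob_of_sumM P X f) -(prob_of_sumM P Y g) big_distrl /=.
rewrite sum_pair /=.
apply: eq_bigr => a _; rewrite big_distrr; apply: eq_bigr => b _ /=.
by rewrite (indep_of_cond_entropy HXY) mulrACA.
Qed.

End ConditionalEntropy.

(** * Partially revealed tuples and the uniform law on tuples *)

Definition mask (Omega : Type) (I T : finType) (S : {set I})
    (F : Omega -> I -> T) (w : Omega) : {ffun I -> option T} :=
  [ffun i => if i \in S then Some (F w i) else None].

Lemma maskP (Omega : Type) (I T : finType) (S : {set I})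
    (F : Omega -> I -> T) (w w' : Omega) :
  mask S F w = mask S F w' <-> {in S, F w =1 F w'}.
Proof.
split=> [/ffunP E i iS|E].
  by have := E i; rewrite !ffunE iS => -[].
by apply/ffunP => i; rewrite !ffunE; case: ifP => // /E ->.
Qed.

Lemma entropy_mask_le (R : realType) (Omega : finType) (P : Omega -> R)
    (I T : finType) (F : Omega -> I -> T) (S : {set I}) :
    (forall w, 0 <= P w) -> \sum_w P w = 1 ->
  entropy P (mask S F) <= \sum_(i in S) entropy P (F^~ i).
Proof.
move=> P0 P1; have [n] := ubnP #|S|; elim: n S => // n IHn S leSn.
have [->|[i iS]] := set_0Vmem S.
  rewrite big_set0 entropy_const // => w w'.
  by apply/maskP => i; rewrite inE.
rewrite (big_setD1 i) //=.
have := IHn (S :\ i); rewrite -ltnS (leq_trans _ leSn) ?ltnS => [/(_ isT) IH|]; last first.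
  by rewrite [#|S|](cardsD1 i) iS.
apply: le_trans (lerD (lexx _) IH); apply: le_trans (entropy_pair_le P0 P1 _ _).
apply: entropy_determines => // w w' [Ei /maskP ES]; apply/maskP => i' i'S.
by have [->|i'i] := eqVneq i' i; last by apply: ES; rewrite !inE i'i.
Qed.

Section UniformTuple.
Variables (R : realType) (I T : finType).
Hypothesis T_gt0 : (0 < #|T|)%N.

Local Notation word := {ffun I -> T}.

Definition uniform (_ : word) : R := #|word|%:R^-1.

Lemma card_word_gt0 : 0 < #|word|%:R :> R.
Proof. by rewrite ltr0n card_ffun expn_gt0 T_gt0. Qed.

Lemma uniform_gt0 w : 0 < uniform w.
Proof. by rewrite invr_gt0 card_word_gt0. Qed.

Lemma uniform_ge0 w : 0 <= uniform w.
Proof. by rewrite ltW // uniform_gt0. Qed.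

Lemma uniform_sum1 : \sum_w uniform w = 1.
Proof.
by rewrite sumr_const -[_ *+ _]mulr_natl mulfV // gt_eqF // card_word_gt0.
Qed.

Lemma entropy_uniform : entropy uniform id = #|I|%:R * log2 #|T|%:R.
Proof.
rewrite entropy_sum; under eq_bigr => w _.
  rewrite /prob_of (big_pred1 w) //= {2}/uniform log2V ?card_word_gt0 // card_ffun.
  rewrite natrX log2X ?ltr0n //.
  over.
by rewrite -mulr_suml uniform_sum1 mul1r opprK.
Qed.

Local Notation coord := (fun (w : word) (i : I) => w i).

(** By subadditivity the other coordinates account for at most [#|I| - 1] of the [#|I|] equal shares
    of the total entropy. *)
Lemma entropy_uniform_gap i :
  log2 #|T|%:R <= entropy uniform id - entropy uniform (mask [set~ i] coord).
Proof.
rewrite entropy_uniform.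
have := entropy_mask_le coord [set~ i] uniform_ge0 uniform_sum1.
have : \sum_(i' in [set~ i]) entropy uniform (coord^~ i')
    <= #|[set~ i]|%:R * log2 #|T|%:R.
  rewrite mulr_natl -sumr_const; apply: ler_sum => i' _.
  by apply: entropy_le_log_card; [exact: uniform_ge0|exact: uniform_sum1].
have -> : #|I|%:R = 1 + #|[set~ i]|%:R :> R.
  by rewrite cardsC1 addrC natr1 prednK //; apply/card_gt0P; exists i.
lra.
Qed.

Lemma entropy_uniform_coord i : log2 #|T|%:R <= entropy uniform (coord^~ i).
Proof.
apply: le_trans (entropy_uniform_gap i) _; rewrite lerBlDr.
apply: le_trans (entropy_pair_le uniform_ge0 uniform_sum1 _ _).
apply: entropy_determines; first exact: uniform_ge0.
move=> w w' [Ei /maskP E]; apply/ffunP => i'.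
by have [->|i'i] := eqVneq i' i; last by apply: E; rewrite !inE.
Qed.

End UniformTuple.

(** * Answers to a fixed query tuple; only the files are random *)

Section FixedQueries.
Variables (R : realType) (V : finType) (e : rel V) (L : nat) (At : finType).
Variable a : V -> files_t e L -> At.
Hypothesis a_local : forall v (w w' : files_t e L),
  (forall S : edge_t e, v \in val S -> w S = w' S) -> a v w = a v w'.

Local Notation T := 'rV['F_2]_L.
Local Notation U := (@uniform R (edge_t e) T).
Local Notation known S := (mask S (fun (w : files_t e L) i => w i)).

(** The quantity [h(v, j)]. It involves [a] only through [a v], hence only the query sent to [v],
    which is what lets privacy act on it. *)
Definition edge_entropy (v : V) (j : edge_t e) : R :=
  cond_entropy U (a v) (known [set~ j]).

Definition answers (w : files_t e L) : answers_t V At := [ffun v => a v w].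

Lemma card_file_gt0 : (0 < #|T|)%N.
Proof. by apply/card_gt0P; exists 0. Qed.

Lemma log2_card_file : log2 #|T|%:R = L%:R :> R.
Proof. by rewrite card_mx card_Fp // mul1n natrX log2X // log2_2 mulr1. Qed.

Let U0 w : 0 <= U w. Proof. exact: uniform_ge0 card_file_gt0 w. Qed.
Let U1 : \sum_w U w = 1. Proof. exact: uniform_sum1 card_file_gt0. Qed.

(* Reveal the files one at a time: once the files at [v] are all known, so is
   the answer of [v], which therefore contributes its entropy just before. *)
Lemma edge_entropy_chain (l : seq (V * edge_t e)) :
    pairwise (fun p q : V * edge_t e => p.1 \notin val q.2) l ->
  \sum_(p <- l) edge_entropy p.1 p.2
    <= cond_entropy U answers (known [set j | j \notin map snd l]).
Proof.
elim: l => [|[v j] l IHl] /=; first by rewrite big_nil cond_entropy_ge0.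
case/andP => /allP vl /IHl {}IHl; rewrite big_cons /=.
apply: le_trans (cond_entropy_chain (X := a v)
  (Z' := known [set j | j \notin map snd l]) U0 _ _ _).
(* [edge_entropy v j] conditions on all files but [j], which is more than has been revealed so far,
   so it is a lower bound. *)
- apply: lerD IHl; apply: cond_entropy_determines => // w w' /maskP E.
  by apply/maskP => i; rewrite !inE negb_or => /andP[ij _]; apply: E; rewrite !inE.
- by move=> w w' /ffunP/(_ v); rewrite !ffunE.
(* No later edge of the list contains [v], so every file stored at [v] is now revealed. *)
- move=> w w' /maskP E; apply: a_local => S vS; apply: E; rewrite inE.
  by apply/mapP => -[q /vl vq Sq]; move: vq; rewrite -Sq vS.
- move=> w w' /maskP E; apply/maskP => i; rewrite !inE negb_or => /andP[_ il].
  by apply: E; rewrite inE.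
Qed.

(** Given all other files, only the answers of [u] and [v] can still vary, and together they must
    restore the [L] bits of file [j]. *)
Lemma edge_entropy_pair (j : edge_t e) u v :
    val j = [set u; v] -> determines answers (fun w => w j) ->
  L%:R <= edge_entropy u j + edge_entropy v j.
Proof.
move=> juv dec; rewrite -log2_card_file.
apply: le_trans (entropy_uniform_gap R card_file_gt0 j) _.
apply: le_trans (cond_entropy_pair_le U0 _ _ _); rewrite lerD2r.
apply: entropy_determines => // w w' [Eu Ev /maskP E].
have Ej : w j = w' j.
  apply: dec; apply/ffunP => x; rewrite !ffunE.
  have [->|xu] := eqVneq x u; first exact: Eu.
  have [->|xv] := eqVneq x v; first exact: Ev.
  apply: a_local => S xS; apply: E; rewrite !inE.
  by apply: contraTneq xS => ->; rewrite juv !inE negb_or xu.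
by apply/ffunP => i; have [->//|ij] := eqVneq i j; apply: E; rewrite !inE.
Qed.

Lemma sum_answer_entropy_ge (k : edge_t e) (l : seq (V * edge_t e)) :
    determines answers (fun w => w k) -> k \notin map snd l ->
    pairwise (fun p q : V * edge_t e => p.1 \notin val q.2) l ->
  L%:R + \sum_(p <- l) edge_entropy p.1 p.2 <= \sum_v entropy U (a v).
Proof.
move=> dec kl /edge_entropy_chain chain.
have : entropy U answers <= \sum_v entropy U (a v).
  have := entropy_mask_le (fun w v => a v w) [set: V]%SET U0 U1.
  under eq_bigl do rewrite inE; apply: le_trans.
  apply: entropy_determines => // w w' /maskP E.
  by apply/ffunP => v; rewrite !ffunE E ?inE.
have : entropy U (fun w => (answers w, w k)) <= entropy U answers.
  by apply: entropy_determines => // w w' E; rewrite E (dec _ _ E).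
(* Since [k] is off [l], the files off [l] include file [k]; conditioning on all of them only lowers
   the entropy. *)
have : cond_entropy U answers (known [set j | j \notin map snd l])
    <= cond_entropy U answers (fun w => w k).
  apply: cond_entropy_determines => // w w' /maskP E.
  by apply: E; rewrite inE.
have := entropy_uniform_coord R card_file_gt0 k; rewrite log2_card_file.
by move: chain; rewrite /cond_entropy; lra.
Qed.

(** Indexing by [nat] makes both directions of traversal of a path instances of one statement. *)
Lemma sum_answer_entropy_ge_nat (k : edge_t e) n (v : nat -> V) (j : nat -> edge_t e) :
    determines answers (fun w => w k) -> (forall i, (i < n)%N -> k != j i) ->
    (forall i m, (i < m < n)%N -> v i \notin val (j m)) ->
  L%:R + \sum_(i < n) edge_entropy (v i) (j i) <= \sum_x entropy U (a x).
Proof.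
move=> dec kj vj; pose l := mkseq (fun i => (v i, j i)) n.
have := @sum_answer_entropy_ge k l dec.
rewrite big_map -{1}[n]subn0 -/(index_iota 0 n) big_mkord; apply.
  rewrite -map_comp; apply/mapP => -[i]; rewrite mem_iota /= => lin kji.
  by have := kj _ lin; rewrite kji eqxx.
apply/(pairwiseP (v 0%N, k)) => i m; rewrite !inE size_mkseq => lin lmn lim.
by rewrite !nth_mkseq //= vj // lim.
Qed.

End FixedQueries.

(** * Averaging over the queries of a scheme *)

Section Scheme.
Variables (R : realType) (V : finType) (e : rel V) (L : nat) (Qt At : finType).
Variables (kappa : edge_t e -> queries_t V Qt -> R).
Variables (ans : V -> Qt -> files_t e L -> At).
Hypothesis scheme : is_pir_scheme kappa ans.
(* Only witnesses that there is an edge at all. *)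
Variable k0 : edge_t e.

Local Notation P := (pir_prob (L := L) kappa).
Local Notation U := (@uniform R (edge_t e) 'rV['F_2]_L).

Let kappa_ge0 : forall k q, 0 <= kappa k q. Proof. by case: scheme. Qed.
Let kappa_sum1 : forall k, \sum_q kappa k q = 1. Proof. by case: scheme. Qed.

Let edge_gt0 : 0 < #|edge_t e|%:R :> R.
Proof. by rewrite ltr0n; apply/card_gt0P; exists k0. Qed.

Let U0 w : 0 <= U w. Proof. exact: uniform_ge0 (card_file_gt0 L) w. Qed.
Let U1 : \sum_w U w = 1. Proof. exact: uniform_sum1 (card_file_gt0 L). Qed.

Lemma pir_prob_ge0 o : 0 <= P o.
Proof. by rewrite !mulr_ge0 ?kappa_ge0 ?invr_ge0 ?ler0n. Qed.

Lemma pir_prob_gt0 k q w : 0 < kappa k q -> 0 < P (k, q, w).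
Proof.
move=> kq; rewrite !mulr_gt0 // ?invr_gt0 //.
exact: card_word_gt0 (card_file_gt0 L).
Qed.

Lemma pir_expectation (F : outcome e L Qt -> R) :
  \sum_o P o * F o
    = #|edge_t e|%:R^-1 * \sum_k \sum_q kappa k q * \sum_w U w * F (k, q, w).
Proof.
rewrite sum_pair (sum_pair (fun kq => \sum_w P (kq, w) * F (kq, w))) big_distrr /=.
apply: eq_bigr => k _; rewrite big_distrr; apply: eq_bigr => q _ /=.
rewrite !big_distrr; apply: eq_bigr => w _ /=.
by rewrite /pir_prob /uniform /= !mulrA.
Qed.

Lemma pir_expectation_query (g : edge_t e -> queries_t V Qt -> R) :
  \sum_o P o * g o.1.1 o.1.2
    = #|edge_t e|%:R^-1 * \sum_k \sum_q kappa k q * g k q.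
Proof.
rewrite pir_expectation; congr (_ * _); apply: eq_bigr => k _; apply: eq_bigr => q _.
by rewrite /= -mulr_suml U1 mul1r.
Qed.

Lemma pir_prob_sum1 : \sum_o P o = 1.
Proof.
have := pir_expectation_query (fun _ _ => 1); under eq_bigr do rewrite mulr1.
move=> ->; under eq_bigr => k _.
  under eq_bigr do rewrite mulr1.
  rewrite kappa_sum1; over.
by rewrite sumr_const mulVf // gt_eqF.
Qed.

(** Privacy makes [rv_theta] independent of the query and files at [v]. Testing this on the
    indicator of [k] and on [g] shows that the mean of [g] is the same whichever file is
    requested. *)
Lemma query_law_private v (g : Qt -> R) k :
  \sum_q kappa k q * g (q v) = \sum_o P o * g (rv_Q v o).
Proof.
case: scheme => _ _ _ _ /(_ v) priv.
have := indep_expectation pir_prob_ge0 pir_prob_sum1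
  (fun t => (t == k)%:R) (fun y => g y.1) priv; rewrite /rv_theta /rv_Q /=.
rewrite (pir_expectation_query (fun t q => (t == k)%:R * g (q v))).
rewrite (pir_expectation_query (fun t _ => (t == k)%:R)).
have pick (h : edge_t e -> queries_t V Qt -> R) :
    \sum_t \sum_q kappa t q * ((t == k)%:R * h t q) = \sum_q kappa k q * h k q.
  rewrite (bigD1 k) //= [X in _ + X]big1 ?addr0.
    by apply: eq_bigr => q _; rewrite eqxx mul1r.
  by move=> t tk; rewrite big1 // => q _; rewrite (negbTE tk) mul0r mulr0.
have -> : \sum_t \sum_q kappa t q * (t == k)%:R = 1.
  under eq_bigr do under eq_bigr do rewrite -[_%:R]mulr1.
  by rewrite (pick (fun _ _ => 1)); under eq_bigr do rewrite mulr1.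
rewrite (pick (fun _ q => g (q v))) mulr1.
by move/(mulfI _); apply; rewrite invr_eq0 gt_eqF.
Qed.

Lemma query_law_invariant v (g : Qt -> R) k k' :
  \sum_q kappa k q * g (q v) = \sum_q kappa k' q * g (q v).
Proof. by rewrite !query_law_private. Qed.

(* Concavity of the entropy: the law of the answer is a mixture over the query. *)
Lemma answer_entropy_ge k v :
  \sum_q kappa k q * entropy U (ans v (q v)) <= entropy P (rv_A ans v).
Proof.
pose pA := prob_of P (rv_A ans v).
(* [G x] is the cross-entropy of the answer to query [x] against the overall law of the answer. It
   depends only on the query at [v], so its mean may be taken with [k] requested. *)
pose G x := - \sum_w U w * log2 (pA (ans v x w)).
have -> : entropy P (rv_A ans v) = \sum_q kappa k q * G (q v).
  rewrite (query_law_private v G k) entropy_sum pir_expectation.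
  rewrite (pir_expectation_query (fun _ q => G (q v))) -mulrN; congr (_ * _).
  rewrite -sumrN; apply: eq_bigr => t _; rewrite -sumrN; apply: eq_bigr => q _.
  by rewrite -mulrN.
apply: ler_sum => q _.
have [->|kq] := eqVneq (kappa k q) 0; first by rewrite !mul0r.
have {}kq : 0 < kappa k q by rewrite lt_def kq kappa_ge0.
rewrite ler_pM2l //; apply: entropy_gibbs => // [t|t|].
- exact: (prob_of_ge0 pir_prob_ge0).
- move=> t0; have [w /eqP <-] : exists w, ans v (q v) w == t.
    apply/existsP; apply: contraTT t0; rewrite negb_exists => /forallP no.
    by rewrite /prob_of big_pred0 ?ltxx // => w; apply/negbTE.
  exact: (prob_of_gt0 pir_prob_ge0 (rv_A ans v) (pir_prob_gt0 w kq)).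
- by rewrite sum_prob_of pir_prob_sum1 U1.
Qed.

(** Reliability concerns outcomes of positive probability; queries are independent of the files, so
    a possible [q] occurs with every [w]. *)
Lemma scheme_decodes k (q : queries_t V Qt) : 0 < kappa k q ->
  determines (answers (fun v => ans v (q v))) (fun w : files_t e L => w k).
Proof.
move=> kq w w' E; case: scheme => _ _ _ [dec decP] _.
have := decP _ (pir_prob_gt0 w kq); have := decP _ (pir_prob_gt0 w' kq) => /= <- <-.
congr (dec _ _); apply/ffunP => v; have /ffunP/(_ v) := E.
by rewrite !ffunE.
Qed.

(* The path is traversed once in each direction; privacy then lets the two
   terms of edge [j i] be evaluated as if [j i] were the requested file. *)
Lemma sum_answer_entropy_path (k : edge_t e) n (v : nat -> V) (j : nat -> edge_t e) :
    (forall i, (i < n)%N -> val (j i) = [set v i; v i.+1]) ->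
    (forall i, (i < n)%N -> k != j i) ->
    {in [pred i | i <= n]%N &, injective v} ->
  L%:R + n%:R * L%:R / 2 <= \sum_x entropy P (rv_A ans x).
Proof.
move=> jv kj v_inj; have [_ _ loc _ _] := scheme.
pose a (q : queries_t V Qt) x := ans x (q x).
have aloc q x (w w' : files_t e L) : (forall S : edge_t e, x \in val S -> w S = w' S) ->
  a q x w = a q x w' by exact: loc.
pose h (q : queries_t V Qt) := edge_entropy R (a q).
have v_eq i m : (i <= n -> m <= n -> (v i == v m) = (i == m))%N.
  by move=> lin lmn; rewrite (inj_in_eq v_inj).
(* Forward: among the path edges, [v i] lies only on [j i] and the edge before it. *)
have fwd q : 0 < kappa k q ->
    L%:R + \sum_(i < n) h q (v i) (j i) <= \sum_x entropy U (a q x).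
  move=> /scheme_decodes dec; apply: (sum_answer_entropy_ge_nat R (aloc q) (v := v) (j := j) dec kj).
  move=> i m /andP[im mn]; rewrite jv // !inE !v_eq; lia.
have bwd q : 0 < kappa k q ->
    L%:R + \sum_(i < n) h q (v i.+1) (j i) <= \sum_x entropy U (a q x).
  move=> /scheme_decodes dec.
  (* Backward: edges come in decreasing index, and [v i.+1] lies on no [j m] with [m < i]. *)
  rewrite (reindex_inj rev_ord_inj) /=.
  have := sum_answer_entropy_ge_nat R (aloc q) (n := n)
    (v := fun i => v (n - i.+1).+1) (j := fun i => j (n - i.+1)%N) dec.
  apply=> [i lin|i m /andP[im mn]]; first by rewrite kj //; lia.
  rewrite jv ?inE ?v_eq; lia.
have both q : kappa k q * (L%:R + (\sum_(i < n) (h q (v i) (j i) + h q (v i.+1) (j i))) / 2)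
    <= kappa k q * \sum_x entropy U (a q x).
  have [->|kq] := eqVneq (kappa k q) 0; first by rewrite !mul0r.
  have {}kq : 0 < kappa k q by rewrite lt_def kq kappa_ge0.
  by rewrite ler_pM2l // big_split /=; have := fwd q kq; have := bwd q kq; lra.
have step i : (i < n)%N ->
    L%:R <= \sum_q kappa k q * (h q (v i) (j i) + h q (v i.+1) (j i)).
  move=> lin.
  (* A constant family of answers suffices here, exhibiting [h] as a function of the single query at
     [x]. *)
  pose g x y : R := edge_entropy R (fun=> ans x y) x (j i).
  have -> : \sum_q kappa k q * (h q (v i) (j i) + h q (v i.+1) (j i))
      = \sum_q kappa (j i) q * (h q (v i) (j i) + h q (v i.+1) (j i)).
    under eq_bigr do rewrite mulrDr; under [RHS]eq_bigr do rewrite mulrDr.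
    rewrite !big_split; congr (_ + _).
      exact: (query_law_invariant (v i) (g (v i))).
    exact: (query_law_invariant (v i.+1) (g (v i.+1))).
  have -> : L%:R = \sum_q kappa (j i) q * L%:R :> R.
    by rewrite -mulr_suml kappa_sum1 mul1r.
  apply: ler_sum => q _.
  have [->|jq] := eqVneq (kappa (j i) q) 0; first by rewrite !mul0r.
  have {}jq : 0 < kappa (j i) q by rewrite lt_def jq kappa_ge0.
  rewrite ler_pM2l //.
  exact: (edge_entropy_pair R (aloc q) (jv i lin) (scheme_decodes jq)).
have -> : L%:R + n%:R * L%:R / 2
    = \sum_q kappa k q * L%:R + (\sum_(i < n) L%:R) / 2 :> R.
  by rewrite -mulr_suml kappa_sum1 mul1r sumr_const card_ord mulr_natl.
apply: (@le_trans _ _ (\sum_q kappa k q * \sum_x entropy U (a q x))); last first.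
  under eq_bigr do rewrite mulr_sumr; rewrite exchange_big /=.
  by apply: ler_sum => x _; exact: answer_entropy_ge.
apply: le_trans (ler_sum _ (fun q _ => both q)).
under [leRHS]eq_bigr do rewrite mulrDr mulrA mulr_sumr.
rewrite big_split /= lerD2l -mulr_suml ler_pM2r // exchange_big /=.
by apply: ler_sum => i _; exact: step.
Qed.

End Scheme.

(** * Opening the Hamiltonian cycle, and the capacity bound *)

Lemma hamiltonian_path (V : finType) (e : rel V) : hamiltonian e ->
  exists (n : nat) (v : nat -> V) (j : nat -> edge_t e) (k : edge_t e),
    [/\ #|V| = n.+1,
        forall i, (i < n)%N -> val (j i) = [set v i; v i.+1],
        forall i, (i < n)%N -> k != j i &
        {in [pred i | i <= n]%N &, injective v}].
Proof.
move=> [V3 [[|x p] [s_uniq s_size s_cycle]]]; first by rewrite -s_size in V3.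
pose n := size p; pose v := nth x (x :: p).
have Vn : #|V| = n.+1 by rewrite -s_size.
have v_inj : {in [pred i | i <= n]%N &, injective v}.
  move=> i m; rewrite !inE => lin lmn /eqP.
  by rewrite (nth_uniq x _ _ s_uniq) // => /eqP.
have /(pathP x) e_step : path e x (rcons p x) by [].
have edge u u' : e u u' -> is_edge e [set u; u'].
  by move=> euu'; apply/existsP; exists u; apply/existsP; exists u'; rewrite euu' eqxx.
have e_last : e (v n) (v 0%N).
  have := e_step n; rewrite size_rcons -rcons_cons !nth_rcons /= ltnSn ltnn eqxx.
  exact.
(* The requested file is the edge that closes the cycle; it also serves as the default of [insubd],
   not reached for [i < n]. *)
pose k : edge_t e := exist (is_edge e) _ (edge _ _ e_last).
pose j i : edge_t e := insubd k [set v i; v i.+1].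
have jv i : (i < n)%N -> val (j i) = [set v i; v i.+1].
  move=> lin; rewrite val_insubd edge //.
  have := e_step i; rewrite size_rcons -rcons_cons !nth_rcons /= ltnS (ltnW lin) lin.
  exact.
exists n, v, j, k; split=> // i lin; apply/negP => /eqP kj.
have v_eq a b : (a <= n -> b <= n -> (v a == v b) = (a == b))%N.
  by move=> lan lbn; rewrite (inj_in_eq v_inj).
have v0 : v 0%N \in val (j i) by rewrite -kj !inE eqxx orbT.
have vn : v n \in val (j i) by rewrite -kj !inE eqxx.
(* Both ends of the path on one edge [j i] would force [i = 0] and [n = 1], against [3 <= #|V|]. *)
move: v0 vn; rewrite jv // !inE !v_eq //; lia.
Qed.

Theorem theorem4 (R : realType) (V : finType) (e : rel V) :
  simple_graph e -> hamiltonian e -> vertex_transitive e ->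
  (pir_capacity R e <= (2 / (#|V|%:R + 1) : R)%:E)%E.
Proof.
move=> _ /hamiltonian_path [n [v [j [k [Vn jv kj v_inj]]]]] _.
apply: ge_ereal_sup => _ [L [Qt [At [kappa [ans [L_gt0 scheme ->]]]]]].
have := sum_answer_entropy_path scheme k jv kj v_inj.
rewrite lee_fin /pir_rate Vn -(natr1 n); set D := \sum_x _ => le.
have L0 : 0 < L%:R :> R by rewrite ltr0n.
have n0 : 0 <= n%:R :> R by [].
have LD : L%:R * (n%:R + 1 + 1) <= 2 * D by rewrite !mulrDr mulr1 [L%:R * _]mulrC; move: le; lra.
(* Positivity of the total answer entropy, from [L > 0], allows the rate's denominator to be
   cleared. *)
have D0 : 0 < D by rewrite -(pmulr_rgt0 _ (ltr0Sn R 1)) (lt_le_trans _ LD) // mulr_gt0 //; lra.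
by rewrite ler_pdivrMr // mulrAC ler_pdivlMr //; lra.
Qed.
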